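(* Let $m_1,m_2,L_1,L_2,d_1,d_2,k_1,k_2,M_0,g$ be parameters taking strictly positive real values (two pendula mounted on a cart, essential friction). Put $z_i=k_i-m_iL_ig$, $z_i'=\frac{z_i}{m_iL_i}$, $d_i'=\frac{d_i}{m_iL_i}$ for $i=1,2$, and $$P=(L_2z_1'-L_1z_2')^2+(L_2d_1'-L_1d_2')(d_1'z_2'-d_2'z_1').$$ Let $A=\mathbb{R}[\partial]$ and let $$R=\begin{pmatrix} m_1L_1\partial^2 & m_2L_2\partial^2 & (m_1+m_2+M_0)\partial^2 & -1\\ m_1L_1^2\partial^2+d_1\partial+z_1 & 0 & m_1L_1\partial^2 & 0\\ 0 & m_2L_2^2\partial^2+d_2\partial+z_2 & m_2L_2\partial^2 & 0\end{pmatrix},\qquad M=A^{1\times 4}/A^{1\times 3}R .$$ The system is generically controllable (that is, $M$ is torsion-free for almost all parameter values), with obstructions to genericity $z_1$, $z_2$ and $P$. The complete stratification of the set of admissible parameter values at which at least one of $z_1,z_2,P$ vanishes consists of the following six pairwise disjoint components: 1. $k_1=m_1L_1g,\ k_2=m_2L_2g,\ P=0$; 2. $k_1=m_1L_1g,\ k_2\neq m_2L_2g,\ P=0$; 3. $k_1=m_1L_1g,\ k_2\neq m_2L_2g,\ P\neq0$; 4. $k_1\neq m_1L_1g,\ k_2=m_2L_2g,\ P=0$; 5. $k_1\neq m_1L_1g,\ k_2=m_2L_2g,\ P\neq0$; 6. $k_1\neq m_1L_1g,\ k_2\neq m_2L_2g,\ P=0$. For all parameter values in any of these components, the system is neither controllable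 nor autonomous (i.e. $M$ is neither torsion-free nor a torsion module), and the torsion submodule of $M$ is annihilated by one of the ideals (with $i\in\{1,2\}$) $$\langle m_iL_i^2\partial^2+d_i\partial\rangle,\quad \langle m_iL_i^2\partial^2+d_i\partial+k_i-m_iL_ig\rangle,\quad \langle\partial\rangle,$$ or $$\left\langle 2m_iL_i^2\partial+d_i\pm\sqrt{d_i^2-4m_iL_i^2(k_i-m_iL_ig)}\right\rangle,\quad\text{provided } k_i\le \frac{d_i^2}{4m_iL_i^2}+m_iL_ig .$$
   Context: A linear system with presentation matrix $R\in A^{p\times q}$ has system module $M=A^{1\times q}/A^{1\times p}R$ (the rows of $R$ generate the relations). The system is called controllable if $M$ is torsion-free and autonomous if $M$ is a torsion module. ''The torsion submodule is annihilated by an ideal $I$'' means that $I$ is the annihilator of the torsion submodule. ''Almost all'' means outside a set of measure zero (a proper algebraic subset) in parameter space. Obstructions to genericity are polynomials in the parameters whose vanishing implies the failure of the generic properties. The ideals are ideals of $A=\mathbb{R}[\partial]$. *)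

(* Defs.v *)
From HB Require Import structures.
From mathcomp Require Import all_boot all_order all_algebra.
From mathcomp Require Import generic_quotient ring_quotient.
From mathcomp Require Import all_classical all_reals all_analysis.
(* [mpoly] is not imported: its notations clash with those of the analysis
   library. *)
From mathcomp Require mpoly.

Set Implicit Arguments.
Unset Strict Implicit.
Unset Printing Implicit Defensive.

Import Order.TTheory GRing.Theory Num.Theory.
Import numFieldNormedType.Exports.
Import Quotient.Exports.

Local Open Scope quotient_scope.
Local Open Scope classical_set_scope.
Local Open Scope ring_scope.

Section SystemModule.
Variables (A : idomainType) (p q : nat) (R : 'M[A]_(p, q)).

Definition row_submodule : {pred 'rV[A]_q} :=
  fun v => `[< exists w : 'rV[A]_p, v = w *m R >].

Lemma row_submodule_closed : submod_closed row_submodule.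
Proof.
split; first by apply/asboolP; exists 0; rewrite mul0mx.
move=> a u v /asboolP[w ->] /asboolP[w' ->]; apply/asboolP.
by exists (a *: w + w'); rewrite mulmxDl scalemxAl.
Qed.
HB.instance Definition _ :=
  GRing.isSubmodClosed.Build A 'rV[A]_q row_submodule row_submodule_closed.

Lemma row_submodule_oppr : oppr_closed row_submodule.
Proof. by move=> v v_in; rewrite -scaleN1r rpredZ. Qed.
HB.instance Definition _ :=
  GRing.isOppClosed.Build 'rV[A]_q row_submodule row_submodule_oppr.

(* [Quotient.quot] is only a Z-module in the library; it is given the scalar
   action a *: [v] = [a *: v], see [pi_qscale]. *)
Definition system_module : Type := Quotient.quot row_submodule.
HB.instance Definition _ := GRing.Zmodule.on system_module.

Definition qclass (v : 'rV[A]_q) : system_module :=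
  \pi_(Quotient.quot row_submodule) v.

Definition qscale (a : A) (x : system_module) : system_module :=
  qclass (a *: repr (x : Quotient.quot row_submodule)).

Lemma qclassP (x : system_module) : exists v, x = qclass v.
Proof.
by exists (repr (x : Quotient.quot row_submodule)); rewrite /qclass reprK.
Qed.

Lemma qclassD : {morph qclass : u v / u + v}.
Proof. by move=> u v; rewrite /qclass raddfD. Qed.

Lemma pi_qscale (a : A) (v : 'rV[A]_q) : qscale a (qclass v) = qclass (a *: v).
Proof.
apply/eqP; rewrite /qscale /qclass -Quotient.idealrBE -scalerBr rpredZ //.
by rewrite Quotient.idealrBE reprK.
Qed.

Lemma qscaleA (a b : A) (x : system_module) :
  qscale a (qscale b x) = qscale (a * b) x.
Proof. by have [v ->] := qclassP x; rewrite !pi_qscale scalerA. Qed.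

Lemma qscale1 : left_id 1 qscale.
Proof. by move=> x; have [v ->] := qclassP x; rewrite pi_qscale scale1r. Qed.

Lemma qscaleDr : right_distributive qscale +%R.
Proof.
move=> a x y; have [u ->] := qclassP x; have [v ->] := qclassP y.
by rewrite -qclassD !pi_qscale scalerDr qclassD.
Qed.

Lemma qscaleDl (x : system_module) : {morph qscale^~ x : a b / a + b}.
Proof.
by move=> a b; have [v ->] := qclassP x; rewrite !pi_qscale scalerDl qclassD.
Qed.

HB.instance Definition _ := GRing.Zmodule_isLmodule.Build A system_module
  qscaleA qscale1 qscaleDr qscaleDl.
End SystemModule.

Section Torsion.
Variables (A : idomainType) (M : lmodType A).

Definition torsion_submodule : set M :=
  [set x | exists2 a : A, a != 0 & a *: x = 0].
Definition torsion_free : Prop := torsion_submodule = [set 0].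
Definition torsion_module : Prop := torsion_submodule = setT.
Definition annihilator (N : set M) : set A :=
  [set a | forall x, N x -> a *: x = 0].
End Torsion.

Definition principal_ideal (A : idomainType) (a : A) : set A :=
  range (fun b : A => b * a).

Definition controllable (A : idomainType) p q (R : 'M[A]_(p, q)) : Prop :=
  torsion_free (system_module R).
Definition autonomous (A : idomainType) p q (R : 'M[A]_(p, q)) : Prop :=
  torsion_module (system_module R).

Section Genericity.
Variables (R : realType) (n : nat).
Implicit Types D N Q : set (n.-tuple R).

Definition algebraic_subset D N : Prop :=
  exists S : set (mpoly.mpoly n R),
    N = D `&` [set t | forall f, S f -> mpoly.meval (tnth t) f = 0].
Definition proper_algebraic_subset D N : Prop :=
  algebraic_subset D N /\ N `<` D.
End Genericity.

(* n-dimensional Lebesgue measure, as the iterated integral of the indicator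
   function; by Tonelli this is the n-fold product of the Lebesgue measure on
   the measurable subsets of R^n, the only sets it is used on. *)
Fixpoint lebesgue_tuple (R : realType) (n : nat) :
    set (n.-tuple R) -> \bar R :=
  match n with
  | 0 => fun B => \d_([tuple] : 0.-tuple R) B
  | n'.+1 => fun B => (\int[@lebesgue_measure R]_x
      @lebesgue_tuple R n' [set t | B (cons_tuple (x : R) t)])%E
  end.

Definition for_almost_all (R : realType) n (D Q : set (n.-tuple R)) : Prop :=
  exists N, [/\ proper_algebraic_subset D N, (@lebesgue_tuple R n).-negligible N &
                forall t, D t -> ~ N t -> Q t].

(* f may be a rational function without poles on D, as is [Pobs] below, so
   polynomiality is required of its vanishing locus. *)
Definition obstruction (R : realType) n (D Q : set (n.-tuple R))
    (f : n.-tuple R -> R) : Prop :=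
  proper_algebraic_subset D (D `&` [set t | f t = 0]) /\
  (forall t, D t -> f t = 0 -> ~ Q t).

Section Pendula.
Variable R : realType.

(* The coordinates are (m1, m2, L1, L2, d1, d2, k1, k2, M0, g); the pendula
   1, 2 are numbered 0, 1 : 'I_2. *)
Definition params : Type := 10.-tuple R.
Implicit Types (t : params) (i : 'I_2).

Definition pm t i : R := t`_i.
Definition pL t i : R := t`_(2 + i).
Definition pd t i : R := t`_(4 + i).
Definition pk t i : R := t`_(6 + i).
Definition pM0 t : R := t`_8.
Definition pg t : R := t`_9.

Definition admissible : set params := [set t | forall j, 0 < tnth t j].

Definition z t i : R := pk t i - pm t i * pL t i * pg t.
Definition z' t i : R := z t i / (pm t i * pL t i).
Definition d' t i : R := pd t i / (pm t i * pL t i).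

Definition Pobs t : R :=
  (pL t 1 * z' t 0 - pL t 0 * z' t 1) ^+ 2
  + (pL t 1 * d' t 0 - pL t 0 * d' t 1) * (d' t 0 * z' t 1 - d' t 1 * z' t 0).

(* 'X stands for the derivation. *)
Definition pendula_mx t : 'M[{poly R}]_(3, 4) :=
  let row1 := [:: (pm t 0 * pL t 0) *: 'X^2; (pm t 1 * pL t 1) *: 'X^2;
                  (pm t 0 + pm t 1 + pM0 t) *: 'X^2; -1] in
  let row2 := [:: (pm t 0 * pL t 0 ^+ 2) *: 'X^2 + pd t 0 *: 'X + (z t 0)%:P;
                  0; (pm t 0 * pL t 0) *: 'X^2; 0] in
  let row3 := [:: 0;
                  (pm t 1 * pL t 1 ^+ 2) *: 'X^2 + pd t 1 *: 'X + (z t 1)%:P;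
                  (pm t 1 * pL t 1) *: 'X^2; 0] in
  \matrix_(i < 3, j < 4) (nth [::] [:: row1; row2; row3] i)`_j.

Definition stratum (s : 'I_6) : set params :=
  let k0 t i := pk t i = pm t i * pL t i * pg t in
  nth set0
    [:: [set t | [/\ admissible t,   k0 t 0,   k0 t 1 & Pobs t = 0]];
        [set t | [/\ admissible t,   k0 t 0, ~ k0 t 1 & Pobs t = 0]];
        [set t | [/\ admissible t,   k0 t 0, ~ k0 t 1 & Pobs t <> 0]];
        [set t | [/\ admissible t, ~ k0 t 0,   k0 t 1 & Pobs t = 0]];
        [set t | [/\ admissible t, ~ k0 t 0,   k0 t 1 & Pobs t <> 0]];
        [set t | [/\ admissible t, ~ k0 t 0, ~ k0 t 1 & Pobs t = 0]] ] s.
End Pendula.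

(* Main.v *)
Require Import Defs.
From mathcomp Require Import all_boot all_order all_algebra.
From mathcomp Require Import generic_quotient ring_quotient.
From mathcomp Require Import all_classical all_reals all_analysis.
From mathcomp Require Import ring lra.
From mathcomp Require mpoly.
Import -(notations) mpoly.

Set Implicit Arguments.
Unset Strict Implicit.
Unset Printing Implicit Defensive.

Import Order.TTheory GRing.Theory Num.Theory.
Import numFieldNormedType.Exports.
Import Quotient.Exports.
Local Open Scope quotient_scope.
Local Open Scope classical_set_scope.
Local Open Scope ring_scope.

(* The first row of R eliminates the fourth variable. With c_i = m_i L_i, the
   other two rows become c_1 (b_1, 0, X^2) and c_2 (0, b_2, X^2), where
   b_i = L_i X^2 + d_i' X + z_i'. A class (u_1, u_2, u_3) is torsion iff
   u_3 b_1 b_2 = X^2 (u_1 b_2 + u_2 b_1), so p annihilates the torsion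
   submodule iff b_1 | p u_1 and b_2 | p u_2 whenever
   b_1 b_2 | X^2 (u_1 b_2 + u_2 b_1). Since P is the resultant of b_1 and b_2,
   and z_i = 0 iff X | b_i, Gauss' lemma then determines the annihilator: it is
   (X) if P <> 0 and one z_i vanishes, and if P = 0 it is generated by some b_i
   or by a common linear factor of b_1 and b_2. For genericity, as soon as
   L_1 <> L_2 the product z_1 z_2 P (denominators cleared) is a nonzero
   polynomial in the last coordinate g, hence has finitely many zeros. *)

(** * Annihilating polynomials for a pair with known greatest common divisor *)

Section CoupledPair.
Variable F : fieldType.
Implicit Types a b h n p u : {poly F}.

(* Says that a annihilates the torsion submodule, see [annihilator_pendula]. *)
Definition kills b1 b2 a : Prop := forall u1 u2,
  b1 * b2 %| 'X^2 * (u1 * b2 + u2 * b1) -> (b1 %| a * u1) && (b2 %| a * u2).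

Lemma killsC b1 b2 a : kills b1 b2 a <-> kills b2 b1 a.
Proof.
by split=> K u1 u2; rewrite mulrC addrC => /K; rewrite andbC.
Qed.

(** The pair [(n1, - n2)] makes the sum zero, so it satisfies the hypothesis of [kills] and forces
    [h] to divide [a]. Conversely, once [h] is cancelled, ['X^2] is coprime to [n1 * n2] and drops
    out, and coprimality of [n1] and [n2] splits the divisibility. *)
Lemma kills_gcd h n1 n2 a : h != 0 -> n1 != 0 -> n2 != 0 ->
  coprimep 'X n1 -> coprimep 'X n2 -> coprimep n1 n2 ->
  kills (h * n1) (h * n2) a <-> (h %| a).
Proof.
move=> h0 n10 n20 X1 X2 co12.
have co21 : coprimep n2 n1 by rewrite coprimep_sym.
split=> [K|ha u1 u2].
  have /K /andP[+ _] : h * n1 * (h * n2) %|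
      'X^2 * (n1 * (h * n2) + - n2 * (h * n1)).
    by rewrite (_ : _ + _ = 0) ?mulr0 ?dvdp0//; ring.
  by rewrite dvdp_mul2r.
rewrite (_ : h * n1 * _ = h * (h * (n1 * n2))); last by ring.
rewrite (_ : 'X^2 * _ = h * ('X^2 * (u1 * n2 + u2 * n1))); last by ring.
rewrite dvdp_mul2l// => D.
have {D} D : n1 * n2 %| u1 * n2 + u2 * n1.
  rewrite -(@Gauss_dvdpr _ _ 'X^2); last first.
    by rewrite coprimep_sym coprimep_expl// coprimepMr X1 X2.
  by apply: dvdp_trans D; rewrite dvdp_mulIr.
rewrite !dvdp_mul//.
  have := dvdp_trans (dvdp_mulIr n1 n2) D.
  by rewrite dvdp_addr ?dvdp_mulIr// Gauss_dvdpl.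
have := dvdp_trans (dvdp_mulIl n1 n2) D.
by rewrite dvdp_addl ?dvdp_mulIr// Gauss_dvdpl.
Qed.

(** When ['X] divides only one of the two polynomials, the factor ['X^2] lets a torsion element
    carry one more ['X]. The annihilator is therefore generated by ['X * h], although the gcd is
    only [h]. *)
Lemma kills_Xgcd h n1 n2 a : h != 0 -> n1 != 0 -> n2 != 0 ->
  coprimep 'X h -> coprimep 'X n1 -> coprimep 'X n2 -> coprimep n1 n2 ->
  kills ('X * h * n1) (h * n2) a <-> ('X * h %| a).
Proof.
move=> h0 n10 n20 Xh X1 X2 co12.
have co21 : coprimep n2 n1 by rewrite coprimep_sym.
split=> [K|ha u1 u2].
  (* The test pair is [(n1, - s * n2)] with [s * 'X + t * h = 1]: its sum is
     [h * n1 * n2 * (1 - s * 'X)], which gains a second factor [h]. *)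
  have /Bezout_eq1_coprimepP[[s t] /= st] := Xh.
  have /K /andP[+ _] : 'X * h * n1 * (h * n2) %|
      'X^2 * (n1 * (h * n2) + (- s * n2) * ('X * h * n1)).
    rewrite (_ : _ * (_ + _) = 'X^2 * h * n1 * n2 * (1 - s * 'X)); last by ring.
    by rewrite -st; apply/dvdpP; exists ('X * t); ring.
  by rewrite dvdp_mul2r.
rewrite (_ : _ * n1 * _ = 'X * h * (h * (n1 * n2))); last by ring.
rewrite (_ : 'X^2 * _ = 'X * h * ('X * (u1 * n2 + u2 * 'X * n1))); last by ring.
rewrite dvdp_mul2l ?mulf_neq0 ?polyX_eq0// => D.
have {D} D : n1 * n2 %| u1 * n2 + u2 * 'X * n1.
  rewrite -(@Gauss_dvdpr _ _ 'X); last by rewrite coprimep_sym coprimepMr X1 X2.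
  by apply: dvdp_trans D; rewrite dvdp_mulIr.
apply/andP; split.
  apply: dvdp_mul => //.
  have := dvdp_trans (dvdp_mulIl n1 n2) D.
  by rewrite dvdp_addl ?dvdp_mulIr// Gauss_dvdpl.
apply: dvdp_mul; first exact: dvdp_trans (dvdp_mulIr _ _) ha.
have := dvdp_trans (dvdp_mulIr n1 n2) D.
by rewrite dvdp_addr ?dvdp_mulIr// !Gauss_dvdpl// coprimep_sym.
Qed.
End CoupledPair.

(** * Resultants and common roots of two quadratics *)

Section Quadratics.
Variable F : fieldType.
Implicit Types (a b c x y : F) (p e : {poly F}).

Definition quad a b c : {poly F} := a *: 'X^2 + b *: 'X + c%:P.

(** The resultant of the two quadratics, that is, their expanded Sylvester determinant. *)
Definition quad_res a1 b1 c1 a2 b2 c2 : F :=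
  (a2 * c1 - a1 * c2) ^+ 2 + (a2 * b1 - a1 * b2) * (b1 * c2 - b2 * c1).

Lemma quad_resC a1 b1 c1 a2 b2 c2 :
  quad_res a1 b1 c1 a2 b2 c2 = quad_res a2 b2 c2 a1 b1 c1.
Proof. by rewrite /quad_res; ring. Qed.

Lemma size_quad a b c : a != 0 -> size (quad a b c) = 3.
Proof.
move=> a0; rewrite /quad -addrA size_polyDl size_scale ?size_polyXn//.
by rewrite (leq_ltn_trans (size_polyD _ _))// gtn_max size_polyC
  (leq_ltn_trans (size_scale_leq _ _)) ?size_polyX//; case: (_ != 0).
Qed.

Lemma quad_neq0 a b c : a != 0 -> quad a b c != 0.
Proof. by move=> a0; rewrite -size_poly_gt0 size_quad. Qed.

Lemma horner_quad a b c x : (quad a b c).[x] = a * x ^+ 2 + b * x + c.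
Proof. by rewrite !hornerE/=; ring. Qed.

Lemma coprimepX p : coprimep 'X p = (p.[0] != 0).
Proof. by rewrite coprimep_sym -['X]subr0 coprimep_XsubC. Qed.

Lemma coprimepX_quad a b c : coprimep 'X (quad a b c) = (c != 0).
Proof. by rewrite coprimepX !hornerE/= ?expr0n/= ?mulr0 ?add0r. Qed.

Lemma coprimep_quad a1 b1 c1 a2 b2 c2 : a1 != 0 ->
  quad_res a1 b1 c1 a2 b2 c2 != 0 -> coprimep (quad a1 b1 c1) (quad a2 b2 c2).
Proof.
set s := a2 * b1 - a1 * b2; set r := a2 * c1 - a1 * c2 => a10.
set k := quad_res _ _ _ _ _ _ => k0.
pose l : {poly F} := (a1 * s) *: 'X + (b1 * s - a1 * r)%:P.
(* l is the quotient of s^2 f1 by a2 f1 - a1 f2 = s X + r, and the remainder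
   is a1 times the resultant. *)
apply/Bezout_eq1_coprimepP.
exists ((a1 * k)^-1 *: ((s ^+ 2)%:P - a2 *: l), (a1 * k)^-1 *: (a1 *: l)) => /=.
rewrite -!scalerAl -scalerDr.
have -> : ((s ^+ 2)%:P - a2 *: l) * quad a1 b1 c1 + a1 *: (l * quad a2 b2 c2)
    = (a1 * k)%:P.
  by rewrite /l /quad /k /quad_res -!mul_polyC /s /r; ring.
by rewrite -mul_polyC -polyCM mulVf// mulf_neq0.
Qed.

(** The combination [a2 f1 - a1 f2 = s X + r] has degree one, so its root [- r / s] is the only
    candidate for a common root. It is a root of [f1] because [s^2 f1(- r / s)] is [a1] times the
    resultant. The other roots come from Vieta's formulas, and [s != 0] keeps them distinct. *)
Lemma quad_common_root a1 b1 c1 a2 b2 c2 : a1 != 0 -> a2 != 0 ->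
  quad_res a1 b1 c1 a2 b2 c2 = 0 -> a2 * b1 != a1 * b2 ->
  exists x y1 y2, [/\ y1 != y2, b1 = - a1 * (x + y1), b2 = - a2 * (x + y2),
    quad a1 b1 c1 = a1 *: (('X - x%:P) * ('X - y1%:P)) &
    quad a2 b2 c2 = a2 *: (('X - x%:P) * ('X - y2%:P))].
Proof.
move=> a10 a20; rewrite -subr_eq0.
set s := a2 * b1 - a1 * b2; set r := a2 * c1 - a1 * c2 => k0 s0.
pose x := - r / s.
have sx : s * x = - r by rewrite /x mulrC divfK.
have f1x : a1 * x ^+ 2 + b1 * x + c1 = 0.
  apply: (mulfI (expf_neq0 2 s0)); rewrite mulr0.
  transitivity (a1 * (s * x) ^+ 2 + b1 * (s * x) * s + c1 * s ^+ 2);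
    first by ring.
  rewrite sx; transitivity (a1 * quad_res a1 b1 c1 a2 b2 c2).
    by rewrite /quad_res /s /r; ring.
  by rewrite k0 mulr0.
have f2x : a2 * x ^+ 2 + b2 * x + c2 = 0.
  apply: (mulfI a10); rewrite mulr0.
  transitivity (a2 * (a1 * x ^+ 2 + b1 * x + c1) - (s * x + r)).
    by rewrite /s /r; ring.
  by rewrite f1x sx; ring.
have quadE a b c : a != 0 -> a * x ^+ 2 + b * x + c = 0 ->
    quad a b c = a *: (('X - x%:P) * ('X - (- (b / a) - x)%:P)).
  move=> a0 /eqP; rewrite addrC addr_eq0 => /eqP ->.
  have : b = a * (b / a) by rewrite mulrC divfK.
  move: (b / a) => w ->.
  by rewrite /quad -!mul_polyC; ring.
exists x, (- (b1 / a1) - x), (- (b2 / a2) - x).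
split; [|by field..|exact: quadE|exact: quadE].
apply: contraNneq s0 => /addIr/oppr_inj /eqP.
by rewrite eqr_div// /s => /eqP e; rewrite subr_eq0 mulrC e mulrC.
Qed.

Lemma kills_coprime a1 b1 c1 a2 b2 c2 : a1 != 0 -> a2 != 0 ->
  c1 != 0 -> c2 != 0 -> quad_res a1 b1 c1 a2 b2 c2 != 0 ->
  kills (quad a1 b1 c1) (quad a2 b2 c2) 1.
Proof.
move=> a10 a20 c10 c20 /(coprimep_quad a10) co.
rewrite -[quad a1 _ _]mul1r -[quad a2 _ _]mul1r.
apply/kills_gcd; rewrite ?dvdpp//; first exact: oner_neq0.
- exact: quad_neq0.
- exact: quad_neq0.
- by rewrite coprimepX_quad.
- by rewrite coprimepX_quad.
Qed.

Lemma kills_X a1 b1 a2 b2 c2 p : a1 != 0 -> a2 != 0 -> b1 != 0 ->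
  quad_res a1 b1 0 a2 b2 c2 != 0 ->
  kills (quad a1 b1 0) (quad a2 b2 c2) p <-> ('X %| p).
Proof.
move=> a10 a20 b10 k0.
(* Otherwise 0 would be a common root and the resultant would vanish. *)
have c20 : c2 != 0.
  by apply: contraNneq k0 => ->; rewrite /quad_res; apply/eqP; ring.
have e1 : quad a1 b1 0 = 'X * (a1 *: 'X + b1%:P).
  by rewrite /quad -!mul_polyC; ring.
have := coprimep_quad a10 k0; rewrite e1 coprimepMl => /andP[_ co].
have := @kills_Xgcd _ 1 (a1 *: 'X + b1%:P) (quad a2 b2 c2) p.
rewrite !mulr1 mul1r; apply; rewrite ?oner_neq0 ?quad_neq0 ?coprimepX_quad//.
- by apply: contraTneq (quad_neq0 b1 0 a10) => e; rewrite e1 e mulr0 eqxx.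
- by rewrite coprimep1.
- by rewrite coprimepX !hornerE/= ?mulr0 ?add0r.
Qed.

Lemma kills_common_root a1 a2 x y p : a1 != 0 -> a2 != 0 -> x != 0 -> y != 0 ->
  let f1 := a1 *: (('X - x%:P) * 'X) in
  kills f1 (a2 *: (('X - x%:P) * ('X - y%:P))) p <-> (f1 %| p).
Proof.
move=> a10 a20 x0 y0 f1.
have -> : (f1 %| p) = ('X * ('X - x%:P) %| p) by rewrite dvdpZl// mulrC.
have -> : f1 = 'X * ('X - x%:P) * a1%:P by rewrite /f1 -mul_polyC; ring.
rewrite scalerAr.
apply: kills_Xgcd;
  rewrite ?polyXsubC_eq0 ?polyC_eq0 ?scaler_eq0 ?negb_or ?a20//=.
- by rewrite polyXsubC_eq0.
- by rewrite coprimepX !hornerE oppr_eq0.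
- by rewrite coprimepX hornerC.
- by rewrite coprimepZr// coprimepX !hornerE oppr_eq0.
- by rewrite -[a1%:P]alg_polyC coprimepZl// coprime1p.
Qed.

(** Either the quadratics are proportional, or they share exactly one root [x]. In the latter case
    the annihilator is generated by the common factor, unless one of the remaining roots is 0; then
    the extra ['X] of [kills_Xgcd] completes the common factor to that whole quadratic. *)
Lemma kills_common_factor a1 b1 c1 a2 b2 c2 : a1 != 0 -> a2 != 0 ->
    b1 != 0 -> b2 != 0 -> quad_res a1 b1 c1 a2 b2 c2 = 0 ->
  let K := kills (quad a1 b1 c1) (quad a2 b2 c2) in
  [\/ forall p, K p <-> (quad a1 b1 c1 %| p),
      forall p, K p <-> (quad a2 b2 c2 %| p) |
      exists2 x, root (quad a1 b1 c1) x & forall p, K p <-> ('X - x%:P %| p)].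
Proof.
move=> a10 a20 b10 b20 k0 K.
have [ab|/(quad_common_root a10 a20 k0)[x [y1 [y2 [y12 be1 be2 e1 e2]]]]] :=
    eqVneq (a2 * b1) (a1 * b2).
  have ac : a2 * c1 = a1 * c2.
    (* When [a2 b1 = a1 b2], the resultant collapses to the square of [a2 c1 - a1 c2]. *)
    apply/eqP; rewrite -subr_eq0 -sqrf_eq0 -k0 /quad_res ab subrr mul0r addr0.
    exact/eqP.
  have e2 : quad a2 b2 c2 = quad a1 b1 c1 * (a2 / a1)%:P.
    have -> : b2 = a2 / a1 * b1 by rewrite mulrAC ab mulrC mulKf.
    have -> : c2 = a2 / a1 * c1 by rewrite mulrAC ac mulrC mulKf.
    have {1}-> : a2 = a2 / a1 * a1 by rewrite divfK.
    by set w := a2 / a1; rewrite /quad -!mul_polyC; ring.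
  apply: Or31 => p; rewrite /K e2 -[X in kills X]mulr1.
  have w0 : a2 / a1 != 0 by rewrite mulf_neq0 ?invr_eq0.
  apply: kills_gcd; rewrite ?quad_neq0 ?oner_neq0 ?polyC_eq0 ?coprimep1//.
    by rewrite coprimepX hornerC.
  by rewrite coprime1p.
(* A double root 0 would make the linear coefficient vanish. *)
have x1 : y1 = 0 -> x != 0.
  apply: contra_eqN => /eqP x0; move: b10.
  by rewrite be1 x0 add0r mulf_eq0 negb_or => /andP[].
have x2 : y2 = 0 -> x != 0.
  apply: contra_eqN => /eqP x0; move: b20.
  by rewrite be2 x0 add0r mulf_eq0 negb_or => /andP[].
rewrite /K e1 e2.
have [y10|y10] := eqVneq y1 0.
  apply: Or31 => p; rewrite y10 subr0; apply: kills_common_root => //.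
    exact: x1.
  by rewrite -y10 eq_sym.
have [y20|y20] := eqVneq y2 0.
  apply: Or32 => p; rewrite killsC y20 subr0; apply: kills_common_root => //.
  exact: x2.
(* Neither cofactor vanishes at 0, so [kills_gcd] applies; [x] itself may be 0. *)
apply: Or33; exists x; first by rewrite rootZ// rootM root_XsubC eqxx.
move=> p; rewrite !scalerAr; apply: kills_gcd;
  rewrite ?polyXsubC_eq0 ?scaler_eq0 ?negb_or ?a10 ?a20 ?polyXsubC_eq0//.
- by rewrite coprimepZr// coprimepX !hornerE oppr_eq0.
- by rewrite coprimepZr// coprimepX !hornerE oppr_eq0.
- by rewrite coprimepZl// coprimepZr// coprimep_XsubC root_XsubC eq_sym.
Qed.
End Quadratics.

(** * The torsion submodule of the pendula system *)

Lemma qclass_eq0 (A : idomainType) p q (R : 'M[A]_(p, q)) v :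
  qclass R v = 0 <-> exists w, v = w *m R.
Proof.
have -> : 0 = qclass R 0 by rewrite /qclass raddf0.
rewrite (rwP eqP) /qclass -Quotient.idealrBE subr0.
by split=> [/asboolP|?]; last exact/asboolP.
Qed.

Lemma qclassZ (A : idomainType) p q (R : 'M[A]_(p, q)) x v :
  x *: qclass R v = qclass R (x *: v).
Proof. exact: pi_qscale. Qed.

(** Reduces controllability to membership of 1 in the annihilator, so that one computation of the
    annihilator settles both questions. *)
Lemma torsion_freeP (A : idomainType) (M : lmodType A) :
  torsion_free M <-> annihilator (@torsion_submodule A M) 1.
Proof.
split=> [M0 x|ann]; first by rewrite M0 => ->; rewrite scaler0.
apply/seteqP; split=> x /=; first by move=> /ann; rewrite scale1r.
by move=> ->; exists 1; rewrite ?oner_eq0 ?scaler0.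
Qed.

Section PendulaModule.
Variables (R : realType) (t : params R).
Hypothesis t_adm : admissible t.

(** The linearized equation of pendulum [i] alone, divided by [m_i L_i]. *)
Definition lin_pend (i : 'I_2) : {poly R} :=
  quad (pL t i) (d' t i) (z' t i).

Let c i := pm t i * pL t i.
Local Notation b := lin_pend.

Lemma pm_gt0 i : 0 < pm t i.
Proof.
have := t_adm (widen_ord (erefl : 2 <= 10)%N i).
by rewrite (tnth_nth 0).
Qed.

Lemma pL_gt0 i : 0 < pL t i.
Proof.
have lti : (2 + i < 10)%N by case: i => [[|[]]].
by have := t_adm (Ordinal lti); rewrite (tnth_nth 0).
Qed.

Lemma pd_gt0 i : 0 < pd t i.
Proof.
have lti : (4 + i < 10)%N by case: i => [[|[]]].
by have := t_adm (Ordinal lti); rewrite (tnth_nth 0).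
Qed.

Let c_gt0 i : 0 < c i.
Proof. by rewrite mulr_gt0 ?pm_gt0 ?pL_gt0. Qed.

Lemma lin_pendE i : (pm t i * pL t i ^+ 2) *: 'X^2 + pd t i *: 'X + (z t i)%:P
  = (pm t i * pL t i) *: lin_pend i.
Proof.
have c0 : c i != 0 by rewrite gt_eqF.
have -> : pd t i = c i * d' t i by rewrite /d' mulrC divfK.
have -> : z t i = c i * z' t i by rewrite /z' mulrC divfK.
by rewrite /lin_pend /quad -!mul_polyC /c; ring.
Qed.

Lemma size_lin_pend i : size (lin_pend i) = 3.
Proof. by rewrite size_quad// gt_eqF// pL_gt0. Qed.

Let b_neq0 i : b i != 0.
Proof. by rewrite -size_poly_gt0 size_lin_pend. Qed.

(* Coordinates after elimination of the fourth variable by the first row. *)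
Definition reduced (v : 'rV[{poly R}]_4) (j : 'I_4) : {poly R} :=
  v 0 j + v 0 3 * pendula_mx t 0 j.

Lemma pendula_rowP v : (exists w, v = w *m pendula_mx t) <->
  exists w0 w1, [/\ reduced v 0 = w0 * b 0, reduced v 1 = w1 * b 1 &
                    reduced v 2 = 'X^2 * (w0 + w1)].
Proof.
have c0 i : c i != 0 by rewrite gt_eqF.
have row0 (w : 'rV_3) j : (w *m pendula_mx t) 0 j =
    w 0 0 * pendula_mx t 0 j + w 0 1 * pendula_mx t 1 j
      + w 0 2 * pendula_mx t 2 j.
  rewrite mxE !big_ord_recl big_ord0 addr0 addrA.
  by rewrite (_ : lift _ (lift _ _) = 2)//; [rewrite (_ : lift _ _ = 1)//|];
    apply/val_inj.
split=> [[w ->]|[w0 [w1 [e0 e1 e2]]]].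
  exists (c 0 *: w 0 1), (c 1 *: w 0 2).
  rewrite /reduced !row0 !mxE /= !lin_pendE -!mul_polyC.
  rewrite /c; split; ring.
(* The entry -1 of the first row forces the first coefficient; the other two undo the scaling by
   [c i]. *)
exists (\row_j (nth 0 [:: - v 0 3; (c 0)^-1 *: w0; (c 1)^-1 *: w1] j)).
apply/rowP => j.
have ord_eq (k : 'I_4) : [\/ k = 0, k = 1, k = 2 | k = 3].
  by case: k => [[|[|[|[|//]]]]] ltk; [apply: Or41|apply: Or42|apply: Or43|
    apply: Or44]; apply/val_inj.
have vE k : v 0 k = reduced v k - v 0 3 * pendula_mx t 0 k.
  by rewrite /reduced addrK.
have cK i (p q : {poly R}) : (c i)^-1 *: p * (c i *: q) = p * q.
  by rewrite -scalerAl -scalerAr scalerA mulVf// scale1r.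
have red3 : reduced v 3 = 0 by rewrite /reduced mxE/= mulrN1 subrr.
rewrite row0; case: (ord_eq j) => {ord_eq} ->;
  rewrite ?[LHS]vE ?e0 ?e1 ?e2 !mxE/= ?lin_pendE -/(c 0) -/(c 1) ?cK
  ?mulr0 ?addr0 ?red3 /c -?mul_polyC; ring.
Qed.

Lemma reducedZ x v j : reduced (x *: v) j = x * reduced v j.
Proof. by rewrite /reduced !mxE; ring. Qed.

(** Over the fraction field the first two equations of [pendula_rowP] determine the coefficients as
    quotients by [b 0] and [b 1]. The third equation, with denominators cleared, is the stated
    identity, and [b 0 * b 1] is a common denominator. *)
Lemma torsion_pendulaP v : torsion_submodule (qclass (pendula_mx t) v) <->
  reduced v 2 * b 0 * b 1 = 'X^2 * (reduced v 0 * b 1 + reduced v 1 * b 0).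
Proof.
split=> [[x x0]|E].
  rewrite qclassZ => /qclass_eq0/pendula_rowP[w0 [w1 []]].
  rewrite !reducedZ => e0 e1 e2; apply: (mulfI x0).
  transitivity (x * reduced v 2 * b 0 * b 1); first by ring.
  transitivity ('X^2 * ((x * reduced v 0) * b 1 + (x * reduced v 1) * b 0));
    last by ring.
  by rewrite e0 e1 e2; ring.
exists (b 0 * b 1); first by rewrite mulf_neq0.
rewrite qclassZ; apply/qclass_eq0/pendula_rowP.
exists (reduced v 0 * b 1), (reduced v 1 * b 0).
by rewrite !reducedZ; split; [ring|ring|rewrite -E; ring].
Qed.

Definition fourth0 (u0 u1 u2 : {poly R}) : 'rV[{poly R}]_4 :=
  \row_j (nth 0 [:: u0; u1; u2; 0] j).

Lemma reduced_fourth0 u0 u1 u2 :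
  (reduced (fourth0 u0 u1 u2) 0 = u0) * (reduced (fourth0 u0 u1 u2) 1 = u1) *
  (reduced (fourth0 u0 u1 u2) 2 = u2).
Proof. by rewrite /reduced !mxE/= !mul0r !addr0. Qed.

(** By [torsion_pendulaP] the third reduced coordinate of a torsion class is the quotient in the
    divisibility that defines [kills]. The third equation then follows from the other two by
    cancelling [b 0 * b 1]. *)
Lemma annihilator_pendula :
  annihilator (@torsion_submodule _ (system_module (pendula_mx t))) =
  [set x | kills (b 0) (b 1) x].
Proof.
apply/seteqP; split=> x /=.
  move=> ann u0 u1 /dvdpP[u2 e].
  have /ann : torsion_submodule (qclass (pendula_mx t) (fourth0 u0 u1 u2)).
    by apply/torsion_pendulaP; rewrite !reduced_fourth0 -mulrA -e; ring.
  rewrite qclassZ => /qclass_eq0/pendula_rowP[w0 [w1 []]].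
  rewrite !reducedZ !reduced_fourth0 => -> -> _.
  by rewrite !dvdp_mulIr.
move=> K y; have [v ->] := qclassP y => /torsion_pendulaP e.
have /andP[/dvdpP[w0 e0] /dvdpP[w1 e1]] : (b 0 %| x * reduced v 0) &&
    (b 1 %| x * reduced v 1).
  by apply: K; apply/dvdpP; exists (reduced v 2); rewrite -e; ring.
rewrite qclassZ; apply/qclass_eq0/pendula_rowP; exists w0, w1.
rewrite !reducedZ; split=> //.
apply: (mulIf (b_neq0 0)); apply: (mulIf (b_neq0 1)).
transitivity (x * (reduced v 2 * b 0 * b 1)); first by ring.
rewrite e.
transitivity ('X^2 * ((x * reduced v 0) * b 1 + (x * reduced v 1) * b 0));
  first by ring.
by rewrite e0 e1; ring.
Qed.

Lemma controllable_pendula :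
  controllable (pendula_mx t) <-> kills (b 0) (b 1) 1.
Proof. by rewrite /controllable torsion_freeP annihilator_pendula. Qed.

Lemma not_autonomous_pendula : ~ autonomous (pendula_mx t).
Proof.
(* The class of the third unit vector is not torsion: the identity would read [b 0 * b 1 = 0]. *)
move=> /seteqP[_ /(_ (qclass _ (fourth0 0 0 1)) I)]
  /torsion_pendulaP; rewrite !reduced_fourth0 => /eqP.
by rewrite !mul0r addr0 mulr0 mul1r mulf_eq0 !(negPf (b_neq0 _)).
Qed.
End PendulaModule.

(** * The annihilator where an obstruction vanishes *)

Lemma principal_idealE (F : fieldType) (e : {poly F}) :
  principal_ideal e = [set p | e %| p].
Proof.
apply/seteqP; split=> p /=; first by move=> [q _ <-]; rewrite dvdp_mulIr.
by move=> /dvdpP[q ->]; exists q.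
Qed.

Section PendulaAnnihilator.
Variables (R : realType) (t : params R).
Hypothesis t_adm : admissible t.

Let L_neq0 i : pL t i != 0. Proof. by rewrite gt_eqF ?pL_gt0. Qed.
Let c_neq0 i : pm t i * pL t i != 0.
Proof. by rewrite mulf_neq0// gt_eqF ?pm_gt0. Qed.
Let d'_neq0 i : d' t i != 0.
Proof. by rewrite mulf_neq0 ?invr_eq0// gt_eqF ?pd_gt0. Qed.

Lemma z'_eq0 i : (z' t i == 0) = (z t i == 0).
Proof. by rewrite mulf_eq0 invr_eq0 (negPf (c_neq0 i)) orbF. Qed.

Let K := kills (lin_pend t 0) (lin_pend t 1).

Lemma PobsE : Pobs t =
  quad_res (pL t 0) (d' t 0) (z' t 0) (pL t 1) (d' t 1) (z' t 1).
Proof. by []. Qed.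

Lemma controllable_generic : z t 0 != 0 -> z t 1 != 0 -> Pobs t != 0 ->
  controllable (pendula_mx t).
Proof.
rewrite -!z'_eq0 => z0 z1 P0; apply/(controllable_pendula t_adm).
exact: kills_coprime.
Qed.

Lemma kills_pendula : [\/ z t 0 = 0, z t 1 = 0 | Pobs t = 0] ->
  exists i, [\/ forall p, K p <-> (lin_pend t i %| p),
    forall p, K p <-> ('X %| p) |
    exists2 x, root (lin_pend t i) x & forall p, K p <-> ('X - x%:P %| p)].
Proof.
have [P0 _|P0] := eqVneq (Pobs t) 0.
  have [] := kills_common_factor (L_neq0 0) (L_neq0 1)
    (d'_neq0 0) (d'_neq0 1) P0.
  - by move=> h; exists 0; apply: Or31; exact: h.
  - by move=> h; exists 1; apply: Or31; exact: h.
  - by move=> h; exists 0; apply: Or33; exact: h.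
(* The alternative ['X] does not involve the index, so 0 is an arbitrary choice. *)
case=> [/eqP|/eqP|/eqP]; rewrite -?z'_eq0 ?(negPf P0)// => /eqP z0;
  exists 0; apply: Or32 => p; move: P0; rewrite /K /lin_pend PobsE z0 => P0.
  exact: kills_X.
by rewrite killsC; apply: kills_X => //; rewrite quad_resC.
Qed.

Lemma not_controllable : [\/ z t 0 = 0, z t 1 = 0 | Pobs t = 0] ->
  ~ controllable (pendula_mx t).
Proof.
move=> /kills_pendula[i bad] /(controllable_pendula t_adm) K1.
(* If 1 annihilates the torsion, the generator is a unit, whereas every possible generator has
   positive degree. *)
have dvd1 e : (forall p, K p <-> (e %| p)) -> (size e <= 1)%N.
  by move=> /(_ 1)[/(_ K1)] + _; rewrite dvdp1 => /eqP ->.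
by case: bad => [/dvd1|/dvd1|[x _ /dvd1]];
  rewrite ?size_lin_pend// ?size_polyX ?size_XsubC.
Qed.

(** A real root [x] of the quadratic turns its discriminant into the square of [2 m L^2 x + d]. This
    yields the bound on [k] and makes ['X - x%:P] proportional to one of the two linear
    generators. *)
Lemma annihilatorE : [\/ z t 0 = 0, z t 1 = 0 | Pobs t = 0] ->
  let Ann : set {poly R} :=
    annihilator (@torsion_submodule _ (system_module (pendula_mx t))) in
  exists i : 'I_2,
    let m := pm t i in let L := pL t i in let d := pd t i in
    let k := pk t i in let g := pg t in
    let disc := d ^+ 2 - 4 * m * L ^+ 2 * (k - m * L * g) in
    [\/ Ann = principal_ideal ((m * L ^+ 2) *: 'X^2 + d *: 'X),
        Ann = principal_ideal
          ((m * L ^+ 2) *: 'X^2 + d *: 'X + (k - m * L * g)%:P),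
        Ann = principal_ideal 'X |
        k <= d ^+ 2 / (4 * m * L ^+ 2) + m * L * g /\
        (Ann = principal_ideal
           ((2 * m * L ^+ 2) *: 'X + (d + Num.sqrt disc)%:P) \/
         Ann = principal_ideal
           ((2 * m * L ^+ 2) *: 'X + (d - Num.sqrt disc)%:P))].
Proof.
move=> /kills_pendula[i bad] Ann; exists i => m L d k g disc.
have AnnE e : (forall p, K p <-> (e %| p)) -> Ann = principal_ideal e.
  move=> Ke; rewrite principal_idealE /Ann annihilator_pendula//.
  by apply/seteqP; split=> p /Ke.
have m0 : 0 < m by exact: pm_gt0.
have L0 : 0 < L by exact: pL_gt0.
case: bad => [/AnnE A|/AnnE A|[x rx Kx]];
  [apply: Or42|by apply: Or43|apply: Or44].
  have /= -> := lin_pendE t_adm i.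
  by rewrite A !principal_idealE; apply/seteqP; split=> p /=; rewrite dvdpZl.
have /rootP ax : root ((m * L ^+ 2) *: 'X^2 + d *: 'X + (k - m * L * g)%:P) x.
  by have /= -> := lin_pendE t_adm i; rewrite rootZ.
have ax0 : m * L ^+ 2 * x ^+ 2 + d * x + (k - m * L * g) = 0.
  by rewrite -[RHS]ax !hornerE/=; ring.
have discE : disc = (2 * m * L ^+ 2 * x + d) ^+ 2.
  transitivity ((2 * m * L ^+ 2 * x + d) ^+ 2 -
    4 * m * L ^+ 2 * (m * L ^+ 2 * x ^+ 2 + d * x + (k - m * L * g))).
    by rewrite /disc; ring.
  by rewrite ax0 mulr0 subr0.
have mL0 : 0 < 4 * m * L ^+ 2 by rewrite !mulr_gt0// exprn_gt0.
split.
  rewrite -lerBlDr ler_pdivlMr// mulrC -subr_ge0 -[leRHS]/disc discE.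
  exact: sqr_ge0.
have AnnE' w : w = - (2 * m * L ^+ 2 * x) ->
    Ann = principal_ideal ((2 * m * L ^+ 2) *: 'X + w%:P).
  move=> ->; apply: AnnE => p.
  have -> : (2 * m * L ^+ 2) *: 'X + (- (2 * m * L ^+ 2 * x))%:P =
      (2 * m * L ^+ 2) *: ('X - x%:P) by rewrite -!mul_polyC; ring.
  by rewrite dvdpZl// !mulf_neq0 ?pnatr_eq0 ?expf_neq0 ?gt_eqF.
rewrite discE sqrtr_sqr.
(* The square root is an absolute value, so the sign of [2 m L^2 x + d] selects the generator. *)
have [_|_] := ger0P (2 * m * L ^+ 2 * x + d); [right|left]; apply: AnnE'; ring.
Qed.
End PendulaAnnihilator.

(** * Null sets for the iterated integral and measurability of zero sets *)

Lemma finite_roots (F : fieldType) (p : {poly F}) :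
  p != 0 -> finite_set [set x | root p x].
Proof.
have [n] := ubnP (size p); elim: n p => // n IHn p pn p0.
have [[x px]|noroot] := pselect (exists x, root p x); last first.
  rewrite (_ : [set _ | _] = set0)// -subset0 => x px.
  by apply: noroot; exists x.
have /dvdpP[q pE] : 'X - x%:P %| p by rewrite dvdp_XsubCl.
have q0 : q != 0 by apply: contraNneq p0 => q0; rewrite pE q0 mul0r.
apply: (@sub_finite_set _ _ ([set x] `|` [set y | root q y])).
  by move=> y /=; rewrite pE rootM root_XsubC => /orP[|/eqP]; [right|left].
rewrite finite_setU; split => //; apply: IHn => //.
by move: pn; rewrite pE size_Mmonic ?monicXsubC// size_XsubC addn2/= ltnS.
Qed.

Section LebesgueTuple.
Variable R : realType.

(** The integrand vanishes off the countable, hence null, set [E], so only its restriction to [E]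
    has to be integrated. *)
Lemma lebesgue_tuple_eq0 n (A : set (n.+1.-tuple R)) (E : set R) :
  countable E ->
  (forall x, ~ E x -> lebesgue_tuple [set t | A (cons_tuple x t)] = 0%E) ->
  lebesgue_tuple A = 0%E.
Proof.
move=> cE A0 /=; set f := fun x => lebesgue_tuple _.
have mE (B : set R) : countable B -> measurable B.
  by move=> cB; exact: countable_measurable.
rewrite (_ : f = f \_ E); last first.
  by apply/funext => x; rewrite /patch; case: ifPn => // /negP;
    rewrite inE => /A0.
rewrite -integral_mkcond; apply: null_set_integral.
- exact: mE.
(* Every subset of [E] is countable, hence measurable, so any function is measurable on [E]. *)
- move=> _ Y _; apply: mE; apply: sub_countable cE.
  by apply: subset_card_le; exact: subIsetl.
- exact: countable_lebesgue_measure0.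
Qed.
End LebesgueTuple.

Section ZeroSets.
Variables (R : realType) (n : nat) (f : mpoly n R).

Lemma measurable_meval :
  measurable_fun setT (fun t : n.-tuple R => meval (tnth t) f).
Proof.
under eq_fun do rewrite mevalE.
apply: measurable_sum => m; apply: measurable_realfun.measurable_funM.
  exact: measurable_cst.
apply: measurable_prod => i _; apply: measurable_realfun.measurable_funX.
exact: measurable_tnth.
Qed.

Lemma algebraic_zero_set (D : set (n.-tuple R)) :
  algebraic_subset D (D `&` [set t | meval (tnth t) f = 0]).
Proof.
exists [set f]; congr (_ `&` _); apply/seteqP; split=> t /= ft0.
  by move=> _ ->.
exact: ft0.
Qed.
End ZeroSets.

(** * The obstructions as polynomials in the parameters *)

Section PendulaPolynomials.
(* The obstructions with cleared denominators, over any commutative ring, in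
   the variables v 0, ..., v 9 = m1, m2, L1, L2, d1, d2, k1, k2, M0, g. *)
Definition gen_c (A : comNzRingType) (v : nat -> A) (i : nat) : A :=
  v i * v (2 + i)%N.
Definition gen_z (A : comNzRingType) (v : nat -> A) (i : nat) : A :=
  v (6 + i)%N - gen_c v i * v 9.
Definition gen_P (A : comNzRingType) (v : nat -> A) : A :=
  (v 3 * gen_z v 0 * gen_c v 1 - v 2 * gen_z v 1 * gen_c v 0) ^+ 2
  + (v 3 * v 4 * gen_c v 1 - v 2 * v 5 * gen_c v 0)
    * (v 4 * gen_z v 1 - v 5 * gen_z v 0).

(** Applied to the evaluation morphism, it carries the formula in the indeterminates to the one in
    the parameter values. *)
Lemma gen_z_morph (A B : comNzRingType) (h : {rmorphism A -> B}) v i :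
  h (gen_z v i) = gen_z (h \o v) i.
Proof. by rewrite /gen_z /gen_c !(rmorphB, rmorphM). Qed.

Lemma gen_P_morph (A B : comNzRingType) (h : {rmorphism A -> B}) v :
  h (gen_P v) = gen_P (h \o v).
Proof.
by rewrite /gen_P /gen_z /gen_c !(rmorphB, rmorphD, rmorphXn, rmorphM).
Qed.

Variable R : realType.
Implicit Types t : params R.

Lemma z_gen t (i : 'I_2) : z t i = gen_z (nth 0 t) i.
Proof. by []. Qed.

Lemma Pobs_gen t : admissible t ->
  Pobs t * (gen_c (nth 0 t) 0 * gen_c (nth 0 t) 1) ^+ 2 = gen_P (nth 0 t).
Proof.
move=> ta.
have m0 := pm_gt0 ta 0; have m1 := pm_gt0 ta 1.
have L0 := pL_gt0 ta 0; have L1 := pL_gt0 ta 1.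
rewrite /Pobs /d' /z' !z_gen /gen_P /gen_c /pm /pL /pd/=.
field.
by rewrite !gt_eqF.
Qed.

Definition mvar (j : nat) : mpoly 10 R := mpolyX R (mnm1 (inord j)).

Lemma meval_mvar t j : (j < 10)%N -> meval (tnth t) (mvar j) = t`_j.
Proof. by move=> j10; rewrite mevalXU (tnth_nth 0) inordK. Qed.

Lemma meval_gen_z t i : (i < 2)%N ->
  meval (tnth t) (gen_z mvar i) = gen_z (nth 0 t) i.
Proof.
by case: i => [|[|//]] _; rewrite gen_z_morph /gen_z /gen_c/= !meval_mvar.
Qed.

Lemma meval_gen_P t : meval (tnth t) (gen_P mvar) = gen_P (nth 0 t).
Proof. by rewrite gen_P_morph /gen_P /gen_z /gen_c/= !meval_mvar. Qed.

Definition mbad : mpoly 10 R := gen_z mvar 0 * gen_z mvar 1 * gen_P mvar.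

Lemma meval_mbad t : meval (tnth t) mbad =
  gen_z (nth 0 t) 0 * gen_z (nth 0 t) 1 * gen_P (nth 0 t).
Proof. by rewrite !mevalM !meval_gen_z// meval_gen_P. Qed.
End PendulaPolynomials.

(** * The bad parameters form a null set *)

Section NullSet.
Variable R : realType.

Lemma gen_bad_finite (v : nat -> R) :
  (forall j, (j < 4)%N -> 0 < v j) -> v 3 != v 2 ->
  let w x j := if j == 9 then x else v j in
  finite_set [set x | gen_z (w x) 0 * gen_z (w x) 1 * gen_P (w x) = 0].
Proof.
move=> v_gt0 v32 w.
have v0 j : (j < 4)%N -> v j != 0 by move=> /v_gt0/gt_eqF ->.
(* As functions of the last coordinate [x], the base of the square in [gen_P] is [u - l x] and the
   first factor of the other term is the constant [s]. So [gen_P] is the quadratic [q] with leading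
   coefficient [l ^+ 2], nonzero since [v 3 != v 2]. *)
pose u := v 3 * v 6 * gen_c v 1 - v 2 * v 7 * gen_c v 0.
pose l := (v 3 - v 2) * gen_c v 0 * gen_c v 1.
pose s := v 3 * v 4 * gen_c v 1 - v 2 * v 5 * gen_c v 0.
pose q := quad (l ^+ 2)
  (- (2 * u * l) - s * (v 4 * gen_c v 1 - v 5 * gen_c v 0))
  (u ^+ 2 + s * (v 4 * v 7 - v 5 * v 6)).
pose r (i : nat) := (v (6 + i)%N)%:P - gen_c v i *: 'X.
have r0 i : (i < 2)%N -> r i != 0.
  move=> i2; have c0 : gen_c v i != 0.
    by case: i i2 => [|[|//]] _; rewrite mulf_neq0 ?v0.
  apply: contraNneq c0 => /(congr1 (fun p : {poly R} => p`_1)).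
  by rewrite !coefE/= mulr1 sub0r => /eqP; rewrite oppr_eq0.
have p0 : r 0%N * r 1%N * q != 0.
  rewrite !mulf_neq0 ?r0//; apply: quad_neq0.
  by rewrite expf_neq0// /l /gen_c !mulf_neq0 ?v0// subr_eq0.
apply: sub_finite_set (finite_roots p0) => x /= xE.
apply/rootP; rewrite -[RHS]xE !hornerM horner_quad /r !hornerE/=.
by rewrite /q /gen_P /gen_z /u /s /l /gen_c /w/=; ring.
Qed.

Let bad : set (params R) := @admissible R `&`
  [set t | gen_z (nth 0 t) 0 * gen_z (nth 0 t) 1 * gen_P (nth 0 t) = 0].

Lemma measurable_admissible : measurable (@admissible R : set (params R)).
Proof.
rewrite (_ : @admissible R =
    \bigcap_(j in [set: 'I_10]) [set t | 0 < tnth t j]).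
  apply: fin_bigcap_measurable => // j _.
  rewrite -[X in measurable X]setTI.
  have := @measurable_tnth _ R 10 j measurableT _ (measurable_itv `]0, +oo[).
  by congr (measurable (_ `&` _)); apply/seteqP; split=> t /=;
    rewrite in_itv/= andbT.
by apply/seteqP; split=> t ta j /=; [move=> _|]; exact: ta.
Qed.

Lemma measurable_bad : measurable bad.
Proof.
apply: measurableI; first exact: measurable_admissible.
have := measurable_meval (mbad R) measurableT (measurable_set1 0).
congr measurable; rewrite setTI; apply/seteqP.
by split=> t /=; rewrite meval_mbad.
Qed.

(** The coordinates are integrated one by one. Exceptional values occur only for the second length,
    where equality with the first is excluded, and for the last coordinate, where they are the
    finitely many zeros of a polynomial. *)
Lemma lebesgue_bad : lebesgue_tuple bad = 0%E.
Proof.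
apply: (lebesgue_tuple_eq0 (@countable0 R)) => m0 _.
apply: (lebesgue_tuple_eq0 (@countable0 R)) => m1 _.
apply: (lebesgue_tuple_eq0 (@countable0 R)) => L0 _.
apply: (lebesgue_tuple_eq0 (countable1 L0)) => L1 L10.
apply: (lebesgue_tuple_eq0 (@countable0 R)) => d0 _.
apply: (lebesgue_tuple_eq0 (@countable0 R)) => d1 _.
apply: (lebesgue_tuple_eq0 (@countable0 R)) => k0 _.
apply: (lebesgue_tuple_eq0 (@countable0 R)) => k1 _.
apply: (lebesgue_tuple_eq0 (@countable0 R)) => M0 _.
set S : set (1.-tuple R) := [set t | _].
apply: (@lebesgue_tuple_eq0 _ _ _ [set g | S [tuple g]]) => [|g Sg].
  (* A point of the slice supplies the positivity of the fixed coordinates; an empty slice is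
     trivially countable. *)
  have [[g0 [adm _]]|noS] := pselect (exists g, S [tuple g]); last first.
    rewrite (_ : [set _ | _] = set0) ?countable0// -subset0 => g Sg.
    by apply: noS; exists g.
  pose v := nth 0 [:: m0; m1; L0; L1; d0; d1; k0; k1; M0].
  apply: finite_set_countable; apply: sub_finite_set (@gen_bad_finite v _ _).
  - by move=> g [_].
  - have := pm_gt0 adm 0; have := pm_gt0 adm 1.
    have := pL_gt0 adm 0; have := pL_gt0 adm 1.
    by rewrite /pL /pm /= => ????; case=> [|[|[|[|]]]].
  - by apply/eqP => /= e; apply: L10.
by rewrite /= diracE memNset.
Qed.
End NullSet.

(** * Generic controllability and the stratification *)

Section Genericity.
Variable R : realType.
Local Notation D := (@admissible R).

Definition unit_params (d0 d1 k0 k1 : R) : params R :=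
  [tuple 1; 1; 1; 1; d0; d1; k0; k1; 1; 1].

Lemma unit_params_admissible d0 d1 k0 k1 :
  0 < d0 -> 0 < d1 -> 0 < k0 -> 0 < k1 -> D (unit_params d0 d1 k0 k1).
Proof.
by move=> *; case=> j ltj; rewrite (tnth_nth 0)/=;
  do 10?[case: j ltj => [|j] ltj //].
Qed.

Lemma z_unit_params d0 d1 k0 k1 :
  (z (unit_params d0 d1 k0 k1) 0 = k0 - 1) *
  (z (unit_params d0 d1 k0 k1) 1 = k1 - 1).
Proof. by rewrite /z /pk /pm /pL /pg /= !mulr1. Qed.

Lemma Pobs_unit_params d0 d1 k0 k1 :
  Pobs (unit_params d0 d1 k0 k1) =
  (k0 - k1) ^+ 2 + (d0 - d1) * (d0 * (k1 - 1) - d1 * (k0 - 1)).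
Proof.
rewrite /Pobs /d' /z' !z_unit_params /pm /pL /pd /= !mulr1 !mul1r !divr1.
by ring.
Qed.

Lemma Pobs_eq0 t : D t -> Pobs t = 0 <-> gen_P (nth 0 t) = 0.
Proof.
move=> ta; rewrite -Pobs_gen//.
have c0 i : gen_c (nth 0 t) (i : 'I_2) != 0.
  by rewrite mulf_neq0// gt_eqF//; [exact: pm_gt0|exact: pL_gt0].
split=> [->|/eqP]; first by rewrite mul0r.
by rewrite mulf_eq0 sqrf_eq0 mulf_eq0 (negPf (c0 0)) (negPf (c0 1)) !orbF
  => /eqP.
Qed.

Lemma proper_zero_set (f : params R -> R) (p : mpoly 10 R) :
  (forall t, D t -> f t = 0 <-> meval (tnth t) p = 0) ->
  (exists2 t, D t & f t != 0) ->
  proper_algebraic_subset D (D `&` [set t | f t = 0]).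
Proof.
move=> fp [t Dt ft]; split.
  rewrite (_ : _ `&` _ = D `&` [set t | meval (tnth t) p = 0]).
    exact: algebraic_zero_set.
  by apply/seteqP; split=> x [Dx /(fp x Dx)].
by split=> [x []//|/(_ t Dt)[_ /eqP]]; apply/negP.
Qed.

(** A point off all three zero sets, with [z_1 = 1], [z_2 = 2] and [P = 1]; it shows that each of
    them is proper. *)
Let t1 := unit_params 1 1 2 3.
Let Dt1 : D t1. Proof. by apply: unit_params_admissible; lra. Qed.
Let zt10 : z t1 0 != 0. Proof. by rewrite z_unit_params gt_eqF//; lra. Qed.
Let zt11 : z t1 1 != 0. Proof. by rewrite z_unit_params gt_eqF//; lra. Qed.
Let Pt1 : Pobs t1 != 0.
Proof. by rewrite Pobs_unit_params gt_eqF//; lra. Qed.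

Lemma proper_z (i : 'I_2) :
  proper_algebraic_subset D (D `&` [set t | z t i = 0]).
Proof.
apply: (@proper_zero_set _ (gen_z (@mvar R) i)) => [t _|].
  by rewrite meval_gen_z ?ltn_ord// z_gen.
exists t1 => //.
suff [->|->] : i = 0 \/ i = 1 by [].
by case: i => [[|[|//]] lti]; [left|right]; apply/val_inj.
Qed.

Lemma proper_P : proper_algebraic_subset D (D `&` [set t | Pobs t = 0]).
Proof.
apply: (@proper_zero_set _ (gen_P (@mvar R))) => [t Dt|].
  by rewrite meval_gen_P; exact: Pobs_eq0.
by exists t1.
Qed.

Lemma for_almost_all_generic (Q : set (params R)) :
  (forall t, D t -> z t 0 != 0 -> z t 1 != 0 -> Pobs t != 0 -> Q t) ->
  for_almost_all D Q.
Proof.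
move=> genQ; exists (D `&` [set t | z t 0 * z t 1 * Pobs t = 0]).
have fE t : D t -> z t 0 * z t 1 * Pobs t = 0 <->
    gen_z (nth 0 t) 0 * gen_z (nth 0 t) 1 * gen_P (nth 0 t) = 0.
  move=> Dt; rewrite !z_gen.
  split=> /eqP; rewrite mulf_eq0 => /orP[/eqP->|/eqP/(Pobs_eq0 Dt) ->];
    by rewrite ?mul0r ?mulr0.
split.
- apply: (@proper_zero_set _ (mbad R)).
    by move=> t Dt; rewrite meval_mbad; exact: fE.
  by exists t1; rewrite ?mulf_neq0.
- eexists; split; [exact: measurable_bad|exact: lebesgue_bad|].
  by move=> t [Dt /(fE _ Dt)].
- move=> t Dt /not_andP[//|/eqP]; rewrite !mulf_eq0 !negb_or.
  by move=> /andP[/andP[z0 z1] P0]; exact: genQ.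
Qed.

Lemma stratum_partition : partition [set: 'I_6] (@stratum R)
  (D `&` [set t | [\/ z t 0 = 0, z t 1 = 0 | Pobs t = 0]]).
Proof.
have zE t i : (z t i = 0) = (pk t i = pm t i * pL t i * pg t).
  apply/propext; rewrite /z; split=> [/eqP|->]; last by rewrite subrr.
  by rewrite subr_eq0 => /eqP.
split.
- apply/seteqP; split=> t.
    move=> [[s lts] _]; do 6?[case: s lts => [|s] lts//]; rewrite /stratum/=;
    move=> [Dt k0 k1 P]; split=> //; rewrite /= !zE;
    by [apply: Or31|apply: Or32|apply: Or33].
  move=> [Dt /=]; rewrite !zE => zP.
  have [k0|k0] := pselect (pk t 0 = pm t 0 * pL t 0 * pg t);
  have [k1|k1] := pselect (pk t 1 = pm t 1 * pL t 1 * pg t);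
  have [P|P] := pselect (Pobs t = 0).
  + by exists (@Ordinal 6 0 isT).
  (* Each term of [Pobs] contains some [z' t i], so both vanishing forces [P = 0]. *)
  + case: P; rewrite /Pobs /z'.
    by move: k0 k1; rewrite -!zE => -> ->; ring.
  + by exists (@Ordinal 6 1 isT).
  + by exists (@Ordinal 6 2 isT).
  + by exists (@Ordinal 6 3 isT).
  + by exists (@Ordinal 6 4 isT).
  + by exists (@Ordinal 6 5 isT).
  + by case: zP.
- move=> [i lti] [j ltj] _ _ [t []].
  do 6?[case: i lti => [|i] lti//]; do 6?[case: j ltj => [|j] ltj//];
  rewrite /stratum/= => -[? ? ? ?] [? ? ? ?]; by [apply/val_inj|].
(* Nonemptiness of the strata. At unit parameters with equal damping [P = (k_1 - k_2)^2], so [P = 0]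
   with exactly one [z_i] zero calls for unequal damping. *)
- move=> [s lts] _; do 6?[case: s lts => [|s] lts//]; rewrite /stratum/=;
  [exists (unit_params 1 1 1 1)|exists (unit_params 1 2 1 2)
  |exists (unit_params 1 1 1 2)|exists (unit_params 2 1 2 1)
  |exists (unit_params 1 1 2 1)|exists (unit_params 1 1 2 2)];
  rewrite /= -!zE !z_unit_params Pobs_unit_params;
  split; try (apply: unit_params_admissible; lra); try lra; move=> ?; lra.
Qed.
End Genericity.

Theorem proposition4p1 (R : realType) :
  let D : set (params R) := @admissible R in
  let C : set (params R) := [set t | controllable (pendula_mx t)] in
  [/\ for_almost_all D C,
      [/\ obstruction D C (fun t => z t 0),
          obstruction D C (fun t => z t 1),
          obstruction D C (@Pobs R) &
          forall t, D t -> z t 0 != 0 -> z t 1 != 0 -> Pobs t != 0 -> C t],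
      partition [set: 'I_6] (@stratum R)
        (D `&` [set t | [\/ z t 0 = 0, z t 1 = 0 | Pobs t = 0]]) &
      forall (s : 'I_6) (t : params R), stratum s t ->
        [/\ ~ controllable (pendula_mx t),
            ~ autonomous (pendula_mx t) &
            let Ann : set {poly R} :=
              annihilator
                (@torsion_submodule _ (system_module (pendula_mx t))) in
            exists i : 'I_2,
              let m := pm t i in let L := pL t i in let d := pd t i in
              let k := pk t i in let g := pg t in
              let disc := d ^+ 2 - 4 * m * L ^+ 2 * (k - m * L * g) in
              [\/ Ann = principal_ideal ((m * L ^+ 2) *: 'X^2 + d *: 'X),
                  Ann = principal_ideal
                    ((m * L ^+ 2) *: 'X^2 + d *: 'X + (k - m * L * g)%:P),
                  Ann = principal_ideal 'X |
                  k <= d ^+ 2 / (4 * m * L ^+ 2) + m * L * g /\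
                  (Ann = principal_ideal
                     ((2 * m * L ^+ 2) *: 'X + (d + Num.sqrt disc)%:P) \/
                   Ann = principal_ideal
                     ((2 * m * L ^+ 2) *: 'X + (d - Num.sqrt disc)%:P))]]].
Proof.
move=> D C.
have DP t : D t -> [\/ z t 0 = 0, z t 1 = 0 | Pobs t = 0] -> ~ C t.
  by move=> Dt; exact: not_controllable.
have generic t : D t -> z t 0 != 0 -> z t 1 != 0 -> Pobs t != 0 -> C t.
  by move=> Dt; exact: controllable_generic.
split.
- exact: for_almost_all_generic.
- split=> //.
  + by split; [exact: proper_z|move=> t Dt ?; apply: DP => //; apply: Or31].
  + by split; [exact: proper_z|move=> t Dt ?; apply: DP => //; apply: Or32].
  + by split; [exact: proper_P|move=> t Dt ?; apply: DP => //; apply: Or33].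
- exact: stratum_partition.
- move=> s t st.
  have [Dt bad] : (D `&` [set t | [\/ z t 0 = 0, z t 1 = 0 | Pobs t = 0]]) t.
    by have [<- _ _] := stratum_partition R; exists s.
  split; [exact: DP|exact: not_autonomous_pendula|exact: annihilatorE].
Qed.
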